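(* Let $\tau$ be a Dixmier trace on $\mathcal L_{1,\infty}$ and $B=\tau\circ{\rm diag}\circ D$ the corresponding Banach limit. Then $\tau$ is generated by an $M$-invariant extended limit if and only if $B$ is Cesàro invariant, i.e. $B=B\circ C$.
   Context: $\mu(n,A)$ denotes singular values, $\mu(t,A)=\mu(n,A)$ for $t\in[n,n+1)$; $\mathcal L_{1,\infty}=\{A\text{ compact}:\sup_n(n+1)\mu(n,A)<\infty\}$. Extended limit on $L_\infty(0,\infty)$: positive linear functional agreeing with $\lim_{t\to\infty}$ on functions convergent at $+\infty$. A Dixmier trace on $\mathcal L_{1,\infty}$ is the linear extension of $\mathrm{Tr}_\omega(A)=\omega\big(t\mapsto\frac1{\log(1+t)}\int_0^t\mu(s,A)ds\big)$, $0\le A$, for an extended limit $\omega$ with $\omega(t\mapsto x(t/\beta))=\omega(x)$ for all $\beta>0$. $(Mx)(t)=\frac1{\log t}\int_1^tx(s)\frac{ds}s$ ($t>1$). A Dixmier trace $\tau$ is generated by an $M$-invariant extended limit if there is an extended limit $\omega$ on $L_\infty(0,\infty)$ with $\omega=\omega\circ M$ and $\tau(A)=\mathrm{Tr}_\omega(A)$ for all $0\le A\in\mathcal L_{1,\infty}$. $C$ is the Cesàro operator $(Cx)_n=\frac1{n+1}\sum_{k=0}^nx_k$ on real $l_\infty$. $D:l_\infty\to l_{1,\infty}$ is $(Dx)_k=\log2\cdot x_n/2^n$ for $2^n-1\le k\le 2^{n+1}-2$; ${\rm diag}$ is the diagonal operator in a fixed orthonormal basis; $B=\tau\circ{\rm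 diag}\circ D$ is a Banach limit (positive, $B(1,1,\dots)=1$, shift invariant). *)

(* Defs.v *)
(* mathcomp-analysis over an abstract R : realType,
   complex scalars R[i] from mathcomp-real-closed. *)
From HB Require Import structures.
From mathcomp Require Import all_boot all_order all_algebra.
From mathcomp Require Import all_classical all_reals all_analysis.
From mathcomp Require Import complex.
Import Order.TTheory GRing.Theory Num.Theory.
Import numFieldNormedType.Exports.

Set Implicit Arguments.
Unset Strict Implicit.
Unset Printing Implicit Defensive.

Local Open Scope classical_set_scope.
Local Open Scope complex_scope.
Local Open Scope ring_scope.

Section DixmierDefs.
Variable R : realType.
Local Notation C := R[i].

(* ---------- The Hilbert space l^2(N; C) with its standard basis ---------- *)
Definition vec := nat -> C.
(* operators are represented by functions on all sequences; only their
   behaviour on l^2 matters *)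
Definition op := vec -> vec.

Definition sqabs (z : C) : R := complex.Re z ^+ 2 + complex.Im z ^+ 2.

Definition is_l2 (x : vec) : Prop :=
  exists K : R, forall n, \sum_(k < n) sqabs (x k) <= K.

(* ||x||^2 = sum_k |x_k|^2 (supremum of the partial sums) *)
Definition l2norm (x : vec) : R :=
  Num.sqrt (sup (range (fun n => \sum_(k < n) sqabs (x k)))).

(* real and imaginary parts of <A x, x> = sum_k (A x)_k conj(x_k) *)
Definition quad_re (A : op) (x : vec) : R :=
  limn (fun n => \sum_(k < n) complex.Re (A x k * (x k)^*)).
Definition quad_im (A : op) (x : vec) : R :=
  limn (fun n => \sum_(k < n) complex.Im (A x k * (x k)^*)).

Definition vadd (x y : vec) : vec := fun k => x k + y k.
Definition vscale (c : C) (x : vec) : vec := fun k => c * x k.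
Definition opadd (A B : op) : op := fun x k => A x k + B x k.
Definition opsub (A B : op) : op := fun x k => A x k - B x k.
Definition opscale (c : C) (A : op) : op := fun x k => c * A x k.

(* bounded linear operator on l^2 *)
Definition bounded_op (A : op) : Prop :=
  (forall x y, is_l2 x -> is_l2 y -> A (vadd x y) = vadd (A x) (A y)) /\
  (forall c x, is_l2 x -> A (vscale c x) = vscale c (A x)) /\
  (forall x, is_l2 x -> is_l2 (A x)) /\
  (exists K : R, forall x, is_l2 x -> l2norm (A x) <= K * l2norm x).

Definition opnorm (A : op) : R :=
  sup [set l2norm (A x) | x in [set x | is_l2 x /\ l2norm x <= 1]].

(* bounded operators of rank at most n *)
Definition rank_le (n : nat) (F : op) : Prop :=
  bounded_op F /\
  exists e : 'I_n -> vec, (forall i, is_l2 (e i)) /\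
    forall x, is_l2 x -> exists c : 'I_n -> C,
      F x = (fun k => \sum_(i < n) c i * e i k).

(* singular values mu(n,A) = inf { ||A - F|| : rank F <= n } *)
Definition mu (A : op) (n : nat) : R :=
  inf [set opnorm (opsub A F) | F in [set F | rank_le n F]].

(* positive operator: <A x, x> >= 0 for all x *)
Definition positive_op (A : op) : Prop :=
  bounded_op A /\ forall x, is_l2 x -> 0 <= quad_re A x /\ quad_im A x = 0.

(* the weak trace ideal L_{1,infty} *)
Definition L1inf (A : op) : Prop :=
  bounded_op A /\ (forall e : R, 0 < e -> exists N, forall n, (N <= n)%N -> mu A n < e)
  /\ exists K : R, forall n, n.+1%:R * mu A n <= K.

(* diagonal operator in the standard basis *)
Definition diag (y : nat -> R) : op := fun x k => (y k)%:C * x k.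

(* ---------- Extended limits on L_infty(0, infty) ---------- *)
Definition pos_half : set R := `]0, +oo[%classic.

(* representatives of elements of L_infty(0,infty): measurable functions
   bounded on (0, infty) *)
Definition Linf (x : R -> R) : Prop :=
  measurable_fun pos_half x /\ exists K : R, forall t, 0 < t -> `|x t| <= K.

(* a positive linear functional on L_infty(0,infty) (hence vanishing on
   functions that are 0 a.e. on (0,infty)) agreeing with lim_{t->oo} *)
Definition extended_limit (om : (R -> R) -> R) : Prop :=
  (forall x y, Linf x -> Linf y -> om (x \+ y) = om x + om y) /\
  (forall (c : R) x, Linf x -> om (fun t => c * x t) = c * om x) /\
  (forall x, Linf x -> (forall t, 0 < t -> 0 <= x t) -> 0 <= om x) /\
  (forall x, Linf x ->
     {ae (@lebesgue_measure R), forall t, pos_half t -> x t = 0} -> om x = 0) /\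
  (forall x (l : R), Linf x -> x t @[t --> +oo] --> l -> om x = l).

Definition dilation_invariant (om : (R -> R) -> R) : Prop :=
  forall x (beta : R), Linf x -> 0 < beta -> om (fun t => x (t / beta)) = om x.

(* (M x)(t) = 1/log t * int_1^t x(s) ds/s for t > 1 (0 elsewhere, which is
   irrelevant for extended limits) *)
Definition Mop (x : R -> R) : R -> R := fun t =>
  if 1 < t then (ln t)^-1 * Rintegral (@lebesgue_measure R)
                              (`[1, t]%classic : set R) (fun s => x s / s)
  else 0.

Definition M_invariant (om : (R -> R) -> R) : Prop :=
  forall x, Linf x -> om (Mop x) = om x.

(* int_0^t mu(s,A) ds for the step function mu(s,A) = mu(floor s, A) *)
Definition int_mu (A : op) (t : R) : R :=
  \sum_(k < Num.truncn t) mu A k + (t - (Num.truncn t)%:R) * mu A (Num.truncn t).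

Definition Tr_omega (om : (R -> R) -> R) (A : op) : R :=
  om (fun t => (ln (1 + t))^-1 * int_mu A t).

(* tau is a Dixmier trace: linear on L_{1,infty} and equal to Tr_omega on
   positive elements for a dilation invariant extended limit omega *)
Definition dixmier_trace (tau : op -> C) : Prop :=
  (forall A B, L1inf A -> L1inf B -> tau (opadd A B) = tau A + tau B) /\
  (forall c A, L1inf A -> tau (opscale c A) = c * tau A) /\
  exists om, extended_limit om /\ dilation_invariant om /\
    forall A, L1inf A -> positive_op A -> tau A = (Tr_omega om A)%:C.

Definition generated_by_M_invariant (tau : op -> C) : Prop :=
  exists om, extended_limit om /\ M_invariant om /\
    forall A, L1inf A -> positive_op A -> tau A = (Tr_omega om A)%:C.

(* ---------- sequence operators ---------- *)
Definition bounded_seq (x : nat -> R) : Prop := exists K : R, forall n, `|x n| <= K.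

Definition cesaro_op (x : nat -> R) : nat -> R :=
  fun n => (n.+1%:R)^-1 * \sum_(k < n.+1) x k.

(* (D x)_k = log 2 * x_n / 2^n  for  2^n - 1 <= k <= 2^(n+1) - 2 *)
Definition Dop (x : nat -> R) : nat -> R :=
  fun k => ln 2 * x (trunc_log 2 k.+1) / 2 ^+ (trunc_log 2 k.+1).

(* B = tau o diag o D *)
Definition banach_limit_of (tau : op -> C) (x : nat -> R) : C :=
  tau (diag (Dop x)).

End DixmierDefs.

(* Main.v *)
(* Write (P x)(t) = x_n for 2^n - 1 <= t < 2^(n+1) - 1. Modulo functions vanishing
   at infinity, M (P x) = P (C x), and every M y is of the form P z (sample M y at
   the powers of 2). If x_n is (log 2)^-1 times the sum of mu(k, A) over the n-th
   dyadic block, then also (log (1 + t))^-1 int_0^t mu(s, A) ds = P (C x) modulo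
   such functions. Hence tau = Tr_om forces B(x) = om (P (C x)) = om (M (P x)).
   If om is M-invariant this is om (P x), and B (C x) = om (P (C x)) = B x.
   Conversely, if tau = Tr_om and B = B o C, then om o M o M is an M-invariant
   extended limit that generates tau. *)
Require Import Defs.
From HB Require Import structures.
From mathcomp Require Import all_boot all_order all_algebra.
From mathcomp Require Import all_classical all_reals all_analysis.
From mathcomp Require Import complex measurable_realfun.
From mathcomp Require Import zify ring lra.
Import Order.TTheory GRing.Theory Num.Theory.
Import numFieldNormedType.Exports.
Set Implicit Arguments.
Unset Strict Implicit.
Unset Printing Implicit Defensive.
Local Open Scope classical_set_scope.
Local Open Scope complex_scope.
Local Open Scope ring_scope.

(** Since B x = om (P (C x)), the identity B = B o C only says that om ignores C on sequences that
    already are Cesaro means. This is why M is applied twice in the converse: the first M turns y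
    into P z with z an arbitrary bounded sequence, the second into P (C z), and only from there on
    does a further M, which acts as a further C, go unnoticed by om. The comparisons modulo
    functions vanishing at infinity share one cause. A dyadic block has bounded logarithmic length
    and carries a bounded sum of singular values, so replacing t by a nearby block boundary changes
    numerators and denominators by O(1), and the division by log t removes the error. The Hilbert
    space part chiefly supplies mu (n, diag v) = v_n for nonincreasing v >= 0. For a general bounded
    x the sequence [Dop x] is neither monotone nor nonnegative, so membership in the ideal and the
    value of B need separate arguments. *)

Section Hilbert.
Variable R : realType.
Implicit Types (x y : vec R) (w v : nat -> R) (A F : op R).

(** * Norms, finite rank operators and singular values of diagonal operators on l^2 *)

Lemma sqabs_ge0 (z : R[i]) : 0 <= sqabs z.
Proof. by rewrite addr_ge0 ?sqr_ge0. Qed.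

Lemma sqabs0 : sqabs (0 : R[i]) = 0.
Proof. by rewrite /sqabs /= expr0n addr0. Qed.

Lemma sqabsM (a b : R[i]) : sqabs (a * b) = sqabs a * sqabs b.
Proof. by case: a b => [a a'] [b b']; rewrite /sqabs /=; ring. Qed.

Lemma sqabs_real (r : R) : sqabs r%:C = r ^+ 2.
Proof. by rewrite /sqabs /= expr0n addr0. Qed.

Lemma sqabs_eq0 (z : R[i]) : (sqabs z == 0) = (z == 0).
Proof.
case: z => a b; rewrite /sqabs /= paddr_eq0 ?sqr_ge0// !sqrf_eq0.
by rewrite eq_complex.
Qed.

Lemma sqabsD_le (a b : R[i]) : sqabs (a + b) <= 2 * sqabs a + 2 * sqabs b.
Proof.
case: a b => [a a'] [b b']; rewrite /sqabs /=.
have := sqr_ge0 (a - b); have := sqr_ge0 (a' - b'); nra.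
Qed.

Lemma sqabsN (a : R[i]) : sqabs (- a) = sqabs a.
Proof. by case: a => a b; rewrite /sqabs /= !sqrrN. Qed.

Lemma l2norm_ge0 x : 0 <= l2norm x.
Proof. exact: sqrtr_ge0. Qed.

Lemma l2norm_le x (K : R) : 0 <= K ->
  (forall n, \sum_(k < n) sqabs (x k) <= K ^+ 2) -> l2norm x <= K.
Proof.
move=> K0 h; rewrite /l2norm -[leRHS]ger0_norm// -sqrtr_sqr ler_wsqrtr//.
apply: ge_sup; first by exists (\sum_(k < 0) sqabs (x k)); exists 0%N.
by move=> _ [n _ <-].
Qed.

Lemma partial_sum_le_l2norm x n :
  is_l2 x -> \sum_(k < n) sqabs (x k) <= l2norm x ^+ 2.
Proof.
move=> [K hK].
have ub : \sum_(k < n) sqabs (x k) <= sup (range (fun n => \sum_(k < n) sqabs (x k))).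
  by apply: ub_le_sup; [exists K => _ [m _ <-]|exists n].
rewrite /l2norm sqr_sqrtr//; apply: le_trans ub.
by apply: sumr_ge0 => i _; exact: sqabs_ge0.
Qed.

Lemma is_l2_finite x n : (forall k, (n <= k)%N -> x k = 0) -> is_l2 x.
Proof.
move=> x0; exists (\sum_(k < n) sqabs (x k)) => m.
rewrite -!(big_mkord xpredT (fun k => sqabs (x k))).
have [mn|nm] := leqP m n.
  rewrite (big_cat_nat (leq0n _) mn)//= lerDl.
  by apply: sumr_ge0 => i _; exact: sqabs_ge0.
rewrite (big_cat_nat (leq0n _) (ltnW nm))//= gerDl big_nat big1// => i /andP[ni _].
by rewrite x0// sqabs0.
Qed.

Lemma l2norm0 : l2norm (fun=> 0 : R[i]) = 0.
Proof.
apply/eqP; rewrite eq_le l2norm_ge0 andbT; apply: l2norm_le => // n.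
by rewrite big1 ?expr0n// => i _; rewrite sqabs0.
Qed.

Lemma is_l20 : is_l2 (fun=> 0 : R[i]).
Proof. exact: (@is_l2_finite _ 0%N). Qed.

Lemma is_l2_vadd x y : is_l2 x -> is_l2 y -> is_l2 (vadd x y).
Proof.
move=> [K hK] [L hL]; exists (2 * K + 2 * L) => n.
apply: (@le_trans _ _ (\sum_(k < n) (2 * sqabs (x k) + 2 * sqabs (y k)))).
  by apply: ler_sum => i _; exact: sqabsD_le.
rewrite big_split/= -!mulr_sumr; apply: lerD; rewrite ler_wpM2l//; [exact: hK|exact: hL].
Qed.

Lemma is_l2_vscale c x : is_l2 x -> is_l2 (vscale c x).
Proof.
move=> [K hK]; exists (sqabs c * K) => n.
under eq_bigr do rewrite sqabsM.
by rewrite -mulr_sumr ler_wpM2l// sqabs_ge0.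
Qed.

Lemma partial_sum_diag_le w (W : R) x n : (forall k, `|w k| <= W) ->
  \sum_(k < n) sqabs (diag w x k) <= W ^+ 2 * \sum_(k < n) sqabs (x k).
Proof.
move=> hw; rewrite mulr_sumr; apply: ler_sum => k _.
rewrite /diag sqabsM sqabs_real ler_wpM2r ?sqabs_ge0//.
have W0 : 0 <= W by apply: le_trans (hw 0%N).
by rewrite -real_normK ?num_real// lerXn2r ?nnegrE.
Qed.

Lemma is_l2_diag w (W : R) x : (forall k, `|w k| <= W) ->
  is_l2 x -> is_l2 (diag w x).
Proof.
move=> hw [K hK]; exists (W ^+ 2 * K) => n.
by apply: le_trans (partial_sum_diag_le _ _ hw) _; rewrite ler_wpM2l ?sqr_ge0.
Qed.

Lemma l2norm_diag_le w (W : R) x : (forall k, `|w k| <= W) ->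
  is_l2 x -> l2norm (diag w x) <= W * l2norm x.
Proof.
move=> hw hx; have W0 : 0 <= W by apply: le_trans (hw 0%N).
apply: l2norm_le => [|n]; first by rewrite mulr_ge0 ?l2norm_ge0.
apply: le_trans (partial_sum_diag_le _ _ hw) _.
by rewrite exprMn ler_wpM2l ?sqr_ge0// partial_sum_le_l2norm.
Qed.

Lemma bounded_op_diag w (W : R) : (forall k, `|w k| <= W) -> bounded_op (diag w).
Proof.
move=> hw; split; [|split; [|split]].
- by move=> x y _ _; apply/funext => k; rewrite /diag /vadd mulrDr.
- by move=> c x _; apply/funext => k; rewrite /diag /vscale mulrCA.
- by move=> x; exact: is_l2_diag hw.
- by exists W => x; exact: l2norm_diag_le.
Qed.

Lemma opnorm_ge0 A : 0 <= opnorm A.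
Proof.
rewrite /opnorm; set E := [set _ | _ in _].
(* For an unbounded operator the set has no supremum and [sup] is 0 by default. *)
have [hE|/sup_out->//] := pselect (has_sup E).
apply: (@le_trans _ _ (l2norm (A (fun=> 0)))); first exact: l2norm_ge0.
apply: ub_le_sup; first by case: hE.
by exists (fun=> 0) => //; split; [exact: is_l20|rewrite l2norm0].
Qed.

Lemma opnorm_le A (K : R) : 0 <= K ->
  (forall x, is_l2 x -> l2norm (A x) <= K * l2norm x) -> opnorm A <= K.
Proof.
move=> K0 h; apply: ge_sup.
  exists (l2norm (A (fun=> 0))); exists (fun=> 0) => //.
  by split; [exact: is_l20|rewrite l2norm0].
move=> _ [x [hx x1] <-]; apply: le_trans (h x hx) _.
by rewrite ler_piMr.
Qed.

Lemma l2norm_le_opnorm A (K : R) x : 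
  (forall x, is_l2 x -> l2norm x <= 1 -> l2norm (A x) <= K) ->
  is_l2 x -> l2norm x <= 1 -> l2norm (A x) <= opnorm A.
Proof.
move=> hK hx x1; apply: ub_le_sup; last by exists x.
by exists K => _ [z [hz z1] <-]; exact: hK.
Qed.

(** [opnorm] is a [sup], which dominates its set only if that set is bounded above; this bound is
    what lower estimates of [opnorm] rest on. *)
Lemma l2norm_opsub_le A F : bounded_op A -> bounded_op F ->
  exists K : R, forall x, is_l2 x -> l2norm x <= 1 -> l2norm (opsub A F x) <= K.
Proof.
move=> [_ [_ [Al2 [K hK]]]] [_ [_ [Fl2 [L hL]]]].
pose S := 2 * K ^+ 2 + 2 * L ^+ 2.
have S0 : 0 <= S by rewrite /S addr_ge0// mulr_ge0// sqr_ge0.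
have sq G (J : R) x n : is_l2 (G x) -> l2norm (G x) <= J * l2norm x -> l2norm x <= 1 ->
    \sum_(k < n) sqabs (G x k) <= J ^+ 2.
  move=> hG hJ x1; apply: le_trans (partial_sum_le_l2norm _ hG) _.
  have h : l2norm (G x) ^+ 2 <= (J * l2norm x) ^+ 2.
    by rewrite lerXn2r ?nnegrE ?l2norm_ge0// (le_trans _ hJ) ?l2norm_ge0.
  apply: le_trans h _.
  by rewrite exprMn ler_piMr ?sqr_ge0// expr_le1// l2norm_ge0.
exists (Num.sqrt S) => x hx x1; apply: l2norm_le; first exact: sqrtr_ge0.
move=> n; rewrite sqr_sqrtr//.
apply: (@le_trans _ _ (\sum_(k < n) (2 * sqabs (A x k) + 2 * sqabs (F x k)))).
  by apply: ler_sum => k _; rewrite -[sqabs (F x k)]sqabsN; exact: sqabsD_le.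
by rewrite big_split/= -!mulr_sumr lerD// ler_wpM2l// sq// ?hK ?hL//; auto.
Qed.

Lemma mu_ge0 A n : 0 <= mu A n.
Proof.
rewrite /mu; set E := [set _ | _ in _].
have [[r Er]|/nonemptyPn E0] := pselect (E !=set0); last first.
  by rewrite E0 inf0.
by apply: lb_le_inf; [exists r|move=> _ [F _ <-]; exact: opnorm_ge0].
Qed.

(** Cutting [w] off after its first [n] entries gives a competitor of rank at most [n] whose
    remainder is bounded by [v n]. A separate majorant [v] allows [w] to be signed and not
    monotone. *)
Lemma mu_diag_le w v n : (forall k, `|w k| <= v k) ->
  (forall j k, (j <= k)%N -> v k <= v j) -> mu (diag w) n <= v n.
Proof.
move=> wv vmono.
pose f k := if (k < n)%N then w k else 0.
pose d (i : nat) : vec R := fun k => (k == i)%:R.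
have fb k : `|f k| <= v 0%N.
  rewrite /f; case: ifP => _; first by rewrite (le_trans (wv k))// vmono.
  by rewrite normr0 (le_trans _ (wv 0%N)).
apply: (@le_trans _ _ (opnorm (opsub (diag w) (diag f)))).
  apply: ge_inf; first by exists 0 => _ [F _ <-]; exact: opnorm_ge0.
  exists (diag f) => //; split; first exact: bounded_op_diag fb.
  exists (fun i : (ordinal n) => d i); split.
    move=> i; apply: (@is_l2_finite _ n) => k nk.
    by rewrite /d gtn_eqF// (leq_trans _ nk).
  move=> x _; exists (fun i => diag f x i); apply/funext => k.
  have [kn|nk] := ltnP k n.
    rewrite (bigD1 (Ordinal kn))//= /d eqxx mulr1 big1 ?addr0// => i ik.
    rewrite [k == i]eq_sym (_ : (i == k :> nat) = false) ?mulr0//.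
    by apply: contra_neqF ik => /eqP ik; exact/val_inj.
  rewrite big1 => [|i _].
    by rewrite /diag /f ltnNge nk mul0r.
  by rewrite /d gtn_eqF ?mulr0// (leq_trans _ nk).
apply: opnorm_le; first exact: le_trans (wv n).
move=> x hx.
have -> : opsub (diag w) (diag f) x = diag (fun k => w k - f k) x.
  by apply/funext => k; rewrite /opsub /diag rmorphB mulrBl.
apply: l2norm_diag_le => // k; rewrite /f; case: ltnP => kn.
  by rewrite subrr normr0 (le_trans _ (wv n)).
by rewrite subr0 (le_trans (wv k))// vmono.
Qed.

Lemma bounded_op_sum F (u : nat -> vec R) (c : nat -> R[i]) m :
  bounded_op F -> (forall i, is_l2 (u i)) ->
  is_l2 (fun k => \sum_(i < m) c i * u i k) /\
  F (fun k => \sum_(i < m) c i * u i k) = fun k => \sum_(i < m) c i * F (u i) k.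
Proof.
move=> [Fadd [Fscale _]] hu; elim: m => [|m [IHl IH]].
  have z : (fun k => \sum_(i < 0) c i * u i k) = vscale 0 (fun=> 0).
    by apply/funext => k; rewrite big_ord0 /vscale mul0r.
  rewrite z Fscale; last exact: is_l20.
  split; first by apply: is_l2_vscale; exact: is_l20.
  by apply/funext => k; rewrite big_ord0 /vscale mul0r.
have z : (fun k => \sum_(i < m.+1) c i * u i k) =
    vadd (fun k => \sum_(i < m) c i * u i k) (vscale (c m) (u m)).
  by apply/funext => k; rewrite big_ord_recr.
have hs : is_l2 (vscale (c m) (u m)) by exact: is_l2_vscale.
rewrite z; split; first exact: is_l2_vadd.
rewrite Fadd// IH Fscale//.
by apply/funext => k; rewrite big_ord_recr.
Qed.

(** The images of the first [n + 1] basis vectors are combinations of [n] vectors, so their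
    [(n + 1) x n] coefficient matrix has a nonzero left kernel vector, which is then normalised. *)
Lemma rank_le_kernel_unit F n : rank_le n F ->
  exists2 v : nat -> R[i], \sum_(i < n.+1) sqabs (v i) = 1 &
    F (fun k => if (k < n.+1)%N then v k else 0) = fun=> 0.
Proof.
move=> [bF [e [he Fe]]].
pose d (i : nat) : vec R := fun k => (k == i)%:R.
have hd i : is_l2 (d i).
  by apply: (@is_l2_finite _ i.+1) => k ik; rewrite /d gtn_eqF.
(* The coefficients in [rank_le] are given vector by vector, with no linearity; they are fixed on
   basis vectors only, and the linearity of [F] does the rest. *)
have /choice[c hc] i := Fe (d i) (hd i).
pose M : 'M[R[i]]_(n.+1, n) := \matrix_(i, j) c i j.
have kM : kermx M != 0.
  rewrite kermx_eq0 /row_free; apply/negP => /eqP rM.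
  by have := rank_leq_col M; rewrite rM ltnn.
have [v /sub_kermxP vM v0] := rowV0Pn kM.
pose S := \sum_(i < n.+1) sqabs (v 0 i).
have S0 : 0 < S.
  rewrite lt0r sumr_ge0 ?andbT; last by move=> i _; exact: sqabs_ge0.
  apply: contra v0; rewrite psumr_eq0; last by move=> i _; exact: sqabs_ge0.
  move=> /allP v0; apply/eqP/rowP => i; rewrite mxE.
  by apply/eqP; rewrite -sqabs_eq0; apply: (v0 i); rewrite mem_index_enum.
pose g k := (Num.sqrt S)^-1%:C * v 0 (inord k).
exists g.
  under eq_bigr => i _ do rewrite /g sqabsM sqabs_real inord_val.
  rewrite -mulr_sumr exprVn sqr_sqrtr; last exact: ltW.
  by rewrite mulVf// gt_eqF.
have -> : (fun k => if (k < n.+1)%N then g k else 0) =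
    fun k => \sum_(i < n.+1) g i * d i k.
  apply/funext => k; case: ifPn => [kn|]; last first.
    rewrite -leqNgt => nk; rewrite big1// => i _.
    by rewrite /d gtn_eqF ?mulr0// (leq_trans _ nk).
  rewrite (bigD1 (Ordinal kn))//= {1}/d eqxx mulr1 big1 ?addr0// => i ik.
  rewrite /d [k == i]eq_sym (_ : (i == k :> nat) = false) ?mulr0//.
  by apply: contra_neqF ik => /eqP ik; exact/val_inj.
have [_ ->] := bounded_op_sum g n.+1 bF hd.
apply/funext => k.
under eq_bigr => i _ do rewrite hc mulr_sumr.
rewrite exchange_big/= big1// => j _.
under eq_bigr => i _ do rewrite mulrA.
rewrite -mulr_suml.
under eq_bigr => i _ do rewrite /g inord_val -mulrA.
rewrite -mulr_sumr.
have /rowP/(_ j) := vM; rewrite !mxE => vMj.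
rewrite (eq_bigr (fun i => v 0 i * M i j)) => [|i _]; last by rewrite mxE.
by rewrite vMj mulr0 mul0r.
Qed.

(* Any operator of rank at most n kills a unit vector in the span of the first
   n + 1 basis vectors, on which diag v expands norms by at least v n. *)
Lemma mu_diag_ge v n : (forall k, 0 <= v k) ->
  (forall j k, (j <= k)%N -> v k <= v j) -> v n <= mu (diag v) n.
Proof.
move=> v0 vmono.
have vb k : `|v k| <= v 0%N by rewrite ger0_norm// vmono.
have bv := bounded_op_diag vb.
apply: lb_le_inf.
  exists (opnorm (opsub (diag v) (diag (fun=> 0)))); exists (diag (fun=> 0)) => //.
  split; first by apply: (@bounded_op_diag _ 0) => k; rewrite normr0.
  exists (fun=> fun=> 0); split; first by move=> _; exact: is_l20.
  move=> x _; exists (fun=> 0); apply/funext => k.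
  by rewrite /diag mul0r big1// => i _; rewrite mul0r.
move=> _ [F rF <-]; have [g g1 Fg] := rank_le_kernel_unit rF.
set x := fun k => if (k < n.+1)%N then g k else 0 in Fg.
have x0 k : (n.+1 <= k)%N -> x k = 0 by rewrite /x leqNgt => /negbTE->.
have hx : is_l2 x by exact: is_l2_finite x0.
have sx m : \sum_(k < m) sqabs (x k) <= 1.
  rewrite -g1 -(big_mkord xpredT (fun k => sqabs (x k))).
  rewrite -(big_mkord xpredT (fun k => sqabs (g k))).
  have gx : \sum_(0 <= k < n.+1) sqabs (g k) = \sum_(0 <= k < n.+1) sqabs (x k).
    by rewrite !big_nat; apply: eq_bigr => i /andP[_ i1]; rewrite /x i1.
  rewrite gx; have [mn|nm] := leqP m n.+1.
    rewrite (big_cat_nat (leq0n _) mn)//= lerDl.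
    by apply: sumr_ge0 => i _; exact: sqabs_ge0.
  rewrite (big_cat_nat (leq0n _) (ltnW nm))//= gerDl big_nat big1// => i /andP[ni _].
  by rewrite x0// sqabs0.
have x1 : l2norm x <= 1 by apply: l2norm_le => // m; rewrite expr1n.
have [K hK] := l2norm_opsub_le bv rF.1.
apply: le_trans (l2norm_le_opnorm hK hx x1).
have -> : opsub (diag v) F x = diag v x.
  by apply/funext => k; rewrite /opsub Fg subr0.
rewrite -(@ler_pXn2r _ 2)// ?nnegrE ?l2norm_ge0//.
apply: le_trans (partial_sum_le_l2norm n.+1 (is_l2_diag vb hx)).
rewrite -[leLHS]mulr1 -g1 mulr_sumr; apply: ler_sum => i _.
rewrite /diag sqabsM sqabs_real /x ltn_ord ler_wpM2r ?sqabs_ge0//.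
by rewrite lerXn2r ?nnegrE// vmono// -ltnS.
Qed.

Lemma mu_diag v n : (forall k, 0 <= v k) ->
  (forall j k, (j <= k)%N -> v k <= v j) -> mu (diag v) n = v n.
Proof.
move=> v0 vmono; apply/eqP; rewrite eq_le mu_diag_ge// andbT.
by apply: mu_diag_le => // k; rewrite ger0_norm.
Qed.

Lemma positive_op_diag v (W : R) : (forall k, 0 <= v k <= W) ->
  positive_op (diag v).
Proof.
move=> hv.
have vb k : `|v k| <= W by have /andP[v0 vW] := hv k; rewrite ger0_norm.
split; first exact: bounded_op_diag vb.
move=> x [K hK].
have re k : complex.Re (diag v x k * (x k)^*) = v k * sqabs (x k).
  by rewrite /diag /sqabs; case: (x k) => a b /=; ring.
have im k : complex.Im (diag v x k * (x k)^*) = 0.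
  by rewrite /diag; case: (x k) => a b /=; ring.
have pos k : 0 <= v k * sqabs (x k).
  by rewrite mulr_ge0 ?sqabs_ge0//; have /andP[] := hv k.
split; last first.
  rewrite /quad_im (_ : (fun _ => _) = cst 0); first exact: lim_cst.
  by apply/funext => n; rewrite big1.
rewrite /quad_re.
have -> : (fun n => \sum_(k < n) complex.Re (diag v x k * (x k)^*)) =
    fun n => \sum_(k < n) (v k * sqabs (x k)).
  by apply/funext => n; apply: eq_bigr.
(* [limn] means something only for a convergent sequence, hence the monotone bounded argument before
   the sign. *)
apply: limr_ge.
  apply: nondecreasing_is_cvgn.
    apply/nondecreasing_seqP => n; rewrite big_ord_recr/= lerDl//.
  exists (W * K) => _ [n _ <-].
  apply: (@le_trans _ _ (\sum_(k < n) (W * sqabs (x k)))).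
    by apply: ler_sum => k _; rewrite ler_wpM2r ?sqabs_ge0//; have /andP[] := hv k.
  rewrite -mulr_sumr ler_wpM2l//; have /andP[+ +] := hv 0%N; exact: le_trans.
by apply: nearW => n; apply: sumr_ge0.
Qed.

End Hilbert.

(** * The operator M, integration against ds/s, and composition of extended limits with M *)

Section LogIntegral.
Variable R : realType.
Implicit Types (x y : R -> R) (s t K : R).
Local Notation leb := (@lebesgue_measure R).

(** [Mop] without its normalisation: increments of this function are additive and compare directly
    with increments of [ln]. *)
Definition log_integral y t : R :=
  Rintegral leb (`[1, t]%classic : set R) (fun s => y s / s).

Lemma measurable_div_id y : measurable_fun (@pos_half R) y ->
  measurable_fun (@pos_half R) (fun s => y s / s).
Proof.
move=> my; apply: measurable_funM => //.
apply: open_continuous_measurable_fun; first exact: interval_open.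
move=> s; rewrite inE /pos_half/= in_itv/= andbT => s0.
by apply: continuousV; rewrite ?gt_eqF//; exact: cvg_id.
Qed.

Lemma integrable_div_id y (a b : R) (p q : bool) : 0 < a -> Linf y ->
  leb.-integrable [set` Interval (BSide p a) (BSide q b)]
    (EFin \o (fun s => y s / s)).
Proof.
move=> a0 [my [K hK]].
have Iab : [set` Interval (BSide p a) (BSide q b)] `<=` `[a, b].
  by apply: subset_itvScc; rewrite bnd_simp; case: p; case: q.
apply: (@integrableS _ _ _ leb (`[a, b]%classic : set R)) => //.
apply: measurable_bounded_integrable => //.
- by apply: compact_finite_measure; exact: segment_compact.
- apply: (measurable_funS _ _ (measurable_div_id my)); first exact: measurable_itv.
  by move=> s /=; rewrite /pos_half /= !in_itv/= andbT => /andP[/(lt_le_trans a0)].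
- exists (K / a); split; first exact: num_real.
  move=> z Kz s /=; rewrite in_itv/= => /andP[as_ _].
  have s0 := lt_le_trans a0 as_.
  rewrite normrM normfV (gtr0_norm s0); apply: le_trans (ltW Kz).
  have K0 : 0 <= K by apply: le_trans (hK _ s0).
  by rewrite ler_pM ?hK ?invr_ge0 ?(ltW s0)// lef_pV2.
Qed.

Lemma Linf_cst (c : R) : Linf (fun=> c).
Proof. by split; [exact: measurable_cst|exists `|c|]. Qed.

Lemma LinfD x y : Linf x -> Linf y -> Linf (x \+ y).
Proof.
move=> [mx [K hK]] [my [L hL]]; split; first exact: measurable_funD.
by exists (K + L) => t t0; rewrite (le_trans (ler_normD _ _))// lerD ?hK ?hL.
Qed.

Lemma LinfZ (c : R) x : Linf x -> Linf (fun t => c * x t).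
Proof.
move=> [mx [K hK]]; split; first exact: measurable_funM.
by exists (`|c| * K) => t t0; rewrite normrM ler_wpM2l ?hK.
Qed.

Lemma LinfB x y : Linf x -> Linf y -> Linf (fun t => x t - y t).
Proof.
move=> hx hy; rewrite (_ : (fun _ => _) = x \+ (fun t => -1 * y t)).
  exact/LinfD/LinfZ.
by apply/funext => t /=; rewrite mulN1r.
Qed.

Lemma Rintegral_inv s t : 0 < s -> s < t ->
  Rintegral leb `[s, t] (fun u => u^-1) = ln t - ln s.
Proof.
move=> s0 st; rewrite /Rintegral.
rewrite (@continuous_FTC2 _ (fun u => u^-1) (@ln R))//.
- apply: continuous_in_subspaceT => u; rewrite inE/= in_itv/= => /andP[su _].
  by apply: continuousV; [rewrite gt_eqF// (lt_le_trans s0)|exact: cvg_id].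
- split.
  + move=> u; rewrite in_itv/= => /andP[su _].
    by apply: ex_derive; apply: is_derive1_ln; exact: lt_trans su.
  + by apply: cvg_at_right_filter; exact: continuous_ln.
  + by apply: cvg_at_left_filter; apply: continuous_ln; exact: lt_trans st.
- move=> u; rewrite in_itv/= => /andP[su _]; rewrite derive1E.
  by have [_ ->] := is_derive1_ln (lt_trans s0 su).
Qed.

(** The increment is taken over a half-open interval because a dyadic step jumps at the right end of
    its block; single points have measure zero. *)
Lemma log_integralB y s t : Linf y -> 1 <= s -> s <= t ->
  log_integral y t - log_integral y s =
  Rintegral leb `[s, t[ (fun u => y u / u).
Proof.
move=> hy s1 st; have s0 : 0 < s by exact: lt_le_trans s1.
rewrite Rintegral_itv_bndo_bndc; last exact: integrable_div_id.
rewrite -Rintegral_itv_obnd_cbnd; last exact: integrable_div_id.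
by rewrite /log_integral Rintegral_itvB//; exact: integrable_div_id.
Qed.

Lemma log_integral_cstB y s t (c : R) : Linf y -> 1 <= s -> s <= t ->
  (forall u, s <= u < t -> y u = c) ->
  log_integral y t - log_integral y s = c * (ln t - ln s).
Proof.
move=> hy s1 st yc; have s0 : 0 < s by exact: lt_le_trans s1.
move: st; rewrite le_eqVlt => /predU1P[<-|st]; first by rewrite !subrr mulr0.
rewrite log_integralB// ?ltW//.
transitivity (Rintegral leb `[s, t[ (fun u => c * (1 / u))).
  apply: eq_Rintegral => u; rewrite inE/= in_itv/= => sut.
  by rewrite (yc _ sut) div1r.
rewrite RintegralZl//; last first.
  exact: (integrable_div_id _ _ _ s0 (Linf_cst 1)).
rewrite Rintegral_itv_bndo_bndc; last first.
  exact: (integrable_div_id _ _ _ s0 (Linf_cst 1)).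
congr (_ * _); rewrite -Rintegral_inv//.
by apply: eq_Rintegral => u _; rewrite div1r.
Qed.

Lemma log_integralD x y t : Linf x -> Linf y ->
  log_integral (x \+ y) t = log_integral x t + log_integral y t.
Proof.
move=> hx hy; rewrite -RintegralD//; [|exact: integrable_div_id..].
by apply: eq_Rintegral => s _; rewrite mulrDl.
Qed.

Lemma log_integralZ (c : R) x t : Linf x ->
  log_integral (fun s => c * x s) t = c * log_integral x t.
Proof.
move=> hx; rewrite -RintegralZl//; last exact: integrable_div_id.
by apply: eq_Rintegral => s _; rewrite mulrA.
Qed.

Lemma log_integral_le x y s t : Linf x -> Linf y -> 1 <= s -> s <= t ->
  (forall u, s <= u < t -> x u <= y u) ->
  log_integral x t - log_integral x s <= log_integral y t - log_integral y s.
Proof.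
move=> hx hy s1 st xy; have s0 : 0 < s by exact: lt_le_trans s1.
rewrite !log_integralB//; apply: le_Rintegral => //; [exact: integrable_div_id..|].
move=> u /=; rewrite in_itv/= => sut; rewrite ler_wpM2r ?xy//.
by rewrite invr_ge0 ltW// (lt_le_trans s0)//; have /andP[] := sut.
Qed.

Lemma log_integral_norm_le y s t K : Linf y -> 1 <= s -> s <= t ->
  (forall u, s <= u < t -> `|y u| <= K) ->
  `|log_integral y t - log_integral y s| <= K * (ln t - ln s).
Proof.
move=> hy s1 st yK.
have c (r : R) := @log_integral_cstB (fun=> r) s t r (Linf_cst r) s1 st
  (fun _ _ => erefl).
rewrite ler_norml -mulNr -!c; apply/andP; split; apply: log_integral_le => //;
  try exact: Linf_cst.
all: by move=> u /yK; rewrite ler_norml => /andP[].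
Qed.

(** The measure ds/s gives [s, t] the mass [ln t - ln s]. Boundedness, continuity and slow variation
    of [Mop y] all come from this estimate. *)
Lemma log_integral_lip y s t K : Linf y -> (forall u, 0 < u -> `|y u| <= K) ->
  1 <= s -> 1 <= t ->
  `|log_integral y t - log_integral y s| <= K * `|ln t - ln s|.
Proof.
move=> hy yK; wlog st : s t / s <= t => [h|] s1 t1.
  have [st|/ltW ts] := leP s t; first exact: h.
  by rewrite distrC [X in _ * X]distrC; exact: h.
have s0 : 0 < s by exact: lt_le_trans s1.
have t0 : 0 < t by exact: lt_le_trans t1.
rewrite [X in _ * X]ger0_norm ?subr_ge0 ?ler_ln//.
by apply: log_integral_norm_le => // u /andP[su _]; rewrite yK// (lt_le_trans s0).
Qed.

Lemma log_integral1 y : log_integral y 1 = 0.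
Proof. by rewrite /log_integral set_itv1 Rintegral_set1. Qed.

Lemma log_integral_bound y t K : Linf y -> (forall u, 0 < u -> `|y u| <= K) ->
  1 <= t -> `|log_integral y t| <= K * ln t.
Proof.
move=> hy yK t1; have := log_integral_lip hy yK (lexx 1) t1.
by rewrite log_integral1 ln1 !subr0 [`|ln t|]ger0_norm// ln_ge0.
Qed.

Lemma MopE y t : 1 < t -> Mop y t = (ln t)^-1 * log_integral y t.
Proof. by rewrite /Mop => ->. Qed.

Lemma Mop_out y t : t <= 1 -> Mop y t = 0.
Proof. by rewrite /Mop ltNge => ->. Qed.

Lemma Mop_bound y t K : Linf y -> (forall u, 0 < u -> `|y u| <= K) ->
  `|Mop y t| <= K.
Proof.
move=> hy yK; have [t1|t1] := leP t 1.
  by rewrite Mop_out// normr0 (le_trans _ (yK 1 _)).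
rewrite MopE// normrM normfV (gtr0_norm (ln_gt0 t1)) ler_pdivrMl ?ln_gt0// mulrC.
by apply: log_integral_bound => //; exact: ltW.
Qed.

Lemma continuous_log_integral y t : Linf y -> 1 < t ->
  {for t, continuous (log_integral y)}.
Proof.
move=> hy t1; have [_ [K yK]] := hy.
have K0 : 0 <= K by apply: le_trans (yK 1 _).
apply/cvgrPdist_le => e e0.
(* [K + 1] instead of [K], since [K] may be 0. *)
have e1 : 0 < e / (K + 1) by rewrite divr_gt0// ltr_wpDl.
have /cvgrPdist_le/(_ _ e1) lnt := @continuous_ln R t (lt_trans ltr01 t1).
near=> s; apply: (le_trans (log_integral_lip hy yK _ _)).
- by near: s; near do apply: ltW; exact: lt_nbhsr.
- exact: ltW.
have h : `|ln t - ln s| <= e / (K + 1) by near: s; exact: lnt.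
apply: (@le_trans _ _ (K * (e / (K + 1)))); first by rewrite ler_wpM2l.
by rewrite mulrCA ler_piMr ?(ltW e0)// ler_pdivrMr ?mul1r ?lerDl// ltr_wpDl.
Unshelve. all: by end_near. Qed.

Lemma Linf_Mop y : Linf y -> Linf (Mop y).
Proof.
move=> hy; have [_ [K yK]] := hy; split; last first.
  by exists K => t _; exact: Mop_bound.
apply: (@measurable_funS _ _ _ _ setT) => //.
apply: measurable_fun_if => //.
- by apply: measurable_fun_ltr => //.
- rewrite setTI; apply: open_continuous_measurable_fun.
    rewrite (_ : _ @^-1` _ = `]1, +oo[%classic); first exact: interval_open.
    by apply/seteqP; split => t /=; rewrite in_itv/= andbT.
  move=> t; rewrite inE/= => t1; apply: cvgM.
    apply: cvgV; first by rewrite gt_eqF// ln_gt0.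
    by apply: continuous_ln; exact: lt_trans t1.
  exact: continuous_log_integral.
Qed.

Lemma MopD x y : Linf x -> Linf y -> Mop (x \+ y) = Mop x \+ Mop y.
Proof.
move=> hx hy; apply/funext => t /=; have [t1|t1] := leP t 1.
  by rewrite !Mop_out// addr0.
by rewrite !MopE// log_integralD// mulrDr.
Qed.

Lemma MopZ (c : R) x : Linf x -> Mop (fun t => c * x t) = fun t => c * Mop x t.
Proof.
move=> hx; apply/funext => t /=; have [t1|t1] := leP t 1.
  by rewrite !Mop_out// mulr0.
by rewrite !MopE// log_integralZ// mulrCA.
Qed.

Lemma Mop_ge0 x : (forall t, 0 < t -> 0 <= x t) -> forall t, 0 <= Mop x t.
Proof.
move=> x0 t; have [t1|t1] := leP t 1; first by rewrite Mop_out.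
rewrite MopE// mulr_ge0 ?invr_ge0 ?ln_ge0 ?(ltW t1)//.
apply: Rintegral_ge0 => s /=; rewrite in_itv/= => /andP[s1 _].
have s0 := lt_le_trans ltr01 s1.
by rewrite divr_ge0 ?x0// ltW.
Qed.

Lemma Mop_ae0 x : Linf x ->
  {ae leb, forall t, pos_half t -> x t = 0} -> Mop x = fun=> 0.
Proof.
move=> hx x0; apply/funext => t /=; have [t1|t1] := leP t 1.
  by rewrite Mop_out.
rewrite MopE// /log_integral /Rintegral.
rewrite (@ae_eq_integral _ _ _ leb _ (cst 0))//.
- by rewrite integral0 mulr0.
- by have /integrableP[] := @integrable_div_id x 1 t true false ltr01 hx.
- have [N [mN N0 sub]] := x0; exists N; split => // s /= xs.
  apply: sub => /= xs0; apply: xs; rewrite in_itv/= => /andP[s1 _].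
  by rewrite xs0 ?mul0r// /pos_half/= in_itv/= andbT (lt_le_trans ltr01).
Qed.

Lemma cvg_lny : ln t @[t --> +oo] --> (+oo : set_system R).
Proof.
apply/cvgryPge => A; near=> t.
have ht : expR A <= t by near: t; apply: nbhs_pinfty_ge; rewrite num_real.
rewrite -[A](expRK) ler_ln ?posrE ?expR_gt0// (lt_le_trans _ ht)// expR_gt0.
Unshelve. all: by end_near. Qed.

(** The common form of the error estimates below: a bounded numerator over a logarithm. The proof
    uses [|K| + 1], which is positive whatever the sign of [K]. *)
Lemma cvg0_le_div (g L : R -> R) K : L t @[t --> +oo] --> +oo ->
  (forall t, 1 < t -> `|g t| * L t <= K) -> g t @[t --> +oo] --> 0.
Proof.
move=> Ly gK; apply/cvgr0Pnorm_le => e e0.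
have /cvgryPge/(_ ((`|K| + 1) / e)) hL := Ly.
near=> t.
have t1 : 1 < t by near: t; apply: nbhs_pinfty_gt; rewrite num_real.
have Lt : (`|K| + 1) / e <= L t by near: t.
have L0 : 0 < L t by apply: lt_le_trans Lt; rewrite divr_gt0// ltr_wpDl.
rewrite -(ler_pM2r L0); apply: (le_trans (gK _ t1)).
move: Lt; rewrite ler_pdivrMr// mulrC; apply: le_trans.
by rewrite (le_trans (ler_norm _))// lerDl.
Unshelve. all: by end_near. Qed.

(** Cut the integral at a point [S] beyond which [x] is at most [e / 2]: the tail contributes at
    most [(e / 2) * ln t], and the head is a fixed number, below [(e / 2) * ln t] for large [t]. *)
Lemma cvg_Mop0 x : Linf x -> x t @[t --> +oo] --> 0 ->
  Mop x t @[t --> +oo] --> 0.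
Proof.
move=> hx /cvgr0Pnorm_le x0; have [_ [K xK]] := hx.
apply/cvgr0Pnorm_le => e e0.
have e2 : 0 < e / 2 by rewrite divr_gt0.
have [T [_ hT]] := x0 _ e2.
pose S := Num.max 1 (T + 1).
have S1 : 1 <= S by rewrite /S le_max lexx.
have S0 : 0 < S by exact: lt_le_trans S1.
have /cvgryPge/(_ (`|log_integral x S| * (2 / e))) hln := cvg_lny.
near=> t.
have tS : S < t by near: t; apply: nbhs_pinfty_gt; rewrite num_real.
have t1 : 1 < t by exact: le_lt_trans tS.
have lnt : `|log_integral x S| * (2 / e) <= ln t by near: t.
have l0 : 0 < ln t by exact: ln_gt0.
rewrite MopE// normrM normfV (gtr0_norm l0) ler_pdivrMl//.
have h : `|log_integral x t - log_integral x S| <= e / 2 * (ln t - ln S).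
  apply: log_integral_norm_le => //.
  move=> u /andP[Su _]; apply: hT; apply: lt_le_trans Su.
  by rewrite /S lt_max [X in _ || X]ltrDl ltr01 orbT.
have h2 : `|log_integral x S| <= ln t * (e / 2).
  by rewrite -ler_pdivrMr// invf_div.
have h3 : e / 2 * (ln t - ln S) <= e / 2 * ln t.
  by rewrite ler_pM2l// gerBl ln_ge0.
have := ler_normD (log_integral x t - log_integral x S) (log_integral x S).
rewrite subrK => h4; apply: (le_trans h4).
apply: (le_trans (lerD h (lexx _))); apply: (le_trans (lerD h3 h2)).
by rewrite [ln t * (e / 2)]mulrC -mulrDl -splitr mulrC.
Unshelve. all: by end_near. Qed.

Lemma Mop_cst (c t : R) : 1 < t -> Mop (fun=> c) t = c.
Proof.
move=> t1; rewrite MopE//.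
have := log_integral_cstB (Linf_cst c) (lexx 1) (ltW t1) (fun _ _ => erefl).
rewrite log_integral1 ln1 !subr0 => ->.
by rewrite mulrCA mulVf ?mulr1// gt_eqF// ln_gt0.
Qed.

Lemma cvg_Mop x (l : R) : Linf x -> x t @[t --> +oo] --> l ->
  Mop x t @[t --> +oo] --> l.
Proof.
move=> hx xl.
have hy : Linf (fun t => x t - l) by apply: LinfB => //; exact: Linf_cst.
have /(cvg_Mop0 hy) y0 : (x t - l) @[t --> +oo] --> (0 : R).
  by rewrite -(subrr l); apply: cvgB => //; exact: cvg_cst.
have : (Mop (fun t => x t - l) t + l) @[t --> +oo] --> (l : R).
  by rewrite -[X in _ --> X]add0r; apply: cvgD => //; exact: cvg_cst.
apply: cvg_trans; apply: near_eq_cvg; near=> t.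
have t1 : 1 < t by near: t; apply: nbhs_pinfty_gt; rewrite num_real.
have -> : x = (fun t => x t - l) \+ (fun=> l).
  by apply/funext => u /=; rewrite subrK.
rewrite MopD//=; last exact: Linf_cst.
rewrite Mop_cst//; congr (Mop _ _ + _).
by apply/funext => u; rewrite addrK.
Unshelve. all: by end_near. Qed.

Lemma extended_limit_eq (om : (R -> R) -> R) x y : extended_limit om ->
  Linf x -> Linf y -> (x t - y t) @[t --> +oo] --> 0 -> om x = om y.
Proof.
move=> [omD [_ [_ [_ oml]]]] hx hy xy.
have hd : Linf (fun t => x t - y t) by exact: LinfB.
have -> : x = y \+ (fun t => x t - y t) by apply/funext => t /=; rewrite addrC subrK.
by rewrite omD// (oml (fun t => x t - y t) 0)// addr0.
Qed.

Lemma cvg_MopB x y : Linf x -> Linf y -> (x t - y t) @[t --> +oo] --> 0 ->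
  (Mop x t - Mop y t) @[t --> +oo] --> 0.
Proof.
move=> hx hy xy.
have -> : (fun t => Mop x t - Mop y t) = Mop (fun t => x t - y t).
  have -> : (fun t => x t - y t) = x \+ (fun t => -1 * y t).
    by apply/funext => t /=; rewrite mulN1r.
  rewrite MopD ?MopZ//; last exact: LinfZ.
  by apply/funext => t /=; rewrite mulN1r.
by apply: cvg_Mop0 => //; exact: LinfB.
Qed.

(** [Mop] is linear and positive, sends functions vanishing almost everywhere to 0, and preserves
    limits at infinity. *)
Lemma extended_limit_comp_Mop (om : (R -> R) -> R) :
  extended_limit om -> extended_limit (fun y => om (Mop y)).
Proof.
move=> [omD [omZ [om0 [omae oml]]]]; split; [|split; [|split; [|split]]].
- by move=> x y hx hy; rewrite MopD// omD//; exact: Linf_Mop.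
- by move=> c x hx; rewrite MopZ// omZ//; exact: Linf_Mop.
- move=> x hx x0; apply: om0; first exact: Linf_Mop.
  by move=> t _; exact: Mop_ge0.
- move=> x hx x0; rewrite (Mop_ae0 hx x0) (oml _ 0)//; first exact: Linf_cst.
  exact: cvg_cst.
- by move=> x l hx xl; apply: oml; [exact: Linf_Mop|exact: cvg_Mop].
Qed.

End LogIntegral.

(** * Step functions on dyadic blocks: M acts on them as the Cesaro operator *)

Section DyadicSteps.
Variable R : realType.
Implicit Types (x z : nat -> R) (y : R -> R) (t K c : R).

(* For t >= 0 this is the n with 2^n <= floor(1 + t) < 2^(n+1), so it also
   indexes the block 2^n - 1 <= k <= 2^(n+1) - 2 of Dop that contains floor t. *)
Definition dyadic_index t : nat := trunc_log 2 (Num.truncn t).+1.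

Definition dyadic_step x : R -> R := fun t => x (dyadic_index t).

Lemma dyadic_index_bounds t : 0 <= t ->
  2 ^+ dyadic_index t <= 1 + t < 2 ^+ (dyadic_index t).+1.
Proof.
move=> t0; have /andP[lo hi] := truncn_itv t0.
have /andP[] := trunc_log_bounds (isT : (1 < 2)%N) (ltn0Sn (Num.truncn t)).
rewrite -(ler_nat R) -[(_ < _)%N](ler_nat R) !natrX -/(dyadic_index t).
rewrite -!natr1 => h1 h2; apply/andP; split.
  by apply: le_trans h1 _; rewrite addrC lerD2l.
by apply: lt_le_trans h2; rewrite addrC ltrD2r natr1.
Qed.

Lemma dyadic_index_eq n t : 2 ^+ n - 1 <= t < 2 ^+ n.+1 - 1 -> dyadic_index t = n.
Proof.
move=> /andP[lo hi].
have t0 : 0 <= t by apply: le_trans lo; rewrite subr_ge0 exprn_ege1 ?ler1n.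
have /andP[lo' hi'] := dyadic_index_bounds t0.
apply/eqP; rewrite eqn_leq; apply/andP; split; rewrite -ltnS.
  by rewrite -(@ltr_eXn2l R 2) ?ltr1n//; lra.
by rewrite -(@ltr_eXn2l R 2) ?ltr1n//; lra.
Qed.

Lemma dyadic_index_gt0 t : 1 <= t -> (0 < dyadic_index t)%N.
Proof.
move=> t1; rewrite trunc_log_gt0/= ltnS truncn_gt0//.
Qed.

Lemma measurable_comp_truncn (g : nat -> R) :
  measurable_fun (@pos_half R) (fun t => g (Num.truncn t)).
Proof.
apply: (@measurable_funS _ _ _ _ setT) => // _ Y mY; rewrite setTI.
have -> : (fun t : R => g (Num.truncn t)) @^-1` Y =
    \bigcup_(n in [set n | Y (g n)]) [set t | Num.truncn t = n].
  apply/seteqP; split => t /=; first by move=> Yt; exists (Num.truncn t).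
  by move=> [n Yn /= ->].
apply: bigcup_measurable => n _.
(* The cell of 0 is unbounded to the left because [Num.truncn] is 0 on negative numbers. *)
have -> : [set t : R | Num.truncn t = n] = if n is 0%N then `]-oo, 1[%classic
    else `[n%:R, n.+1%:R[%classic.
  case: n => [|n]; apply/seteqP; split => t /=; rewrite in_itv/=.
  - by move/truncn0Pn; rewrite -ltNge.
  - by rewrite ltNge => /truncn0Pn.
  - move=> tn; rewrite -tn; apply: truncn_itv; apply: le_trans ler01 _.
    by rewrite -truncn_gt0 tn.
  - exact: truncn_def.
by case: n.
Qed.

Lemma Linf_dyadic_step x : bounded_seq x -> Linf (dyadic_step x).
Proof.
move=> [K xK]; split; last by exists K => t _; exact: xK.
exact: (measurable_comp_truncn (fun n => x (trunc_log 2 n.+1))).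
Qed.

Lemma cesaro_bound x K : (forall n, `|x n| <= K) ->
  forall n, `|cesaro_op x n| <= K.
Proof.
move=> xK n; rewrite /cesaro_op normrM normfV normr_nat ler_pdivrMl ?ltr0n//.
apply: le_trans (ler_norm_sum _ _ _) _.
apply: (@le_trans _ _ (\sum_(k < n.+1) K)); first by apply: ler_sum.
by rewrite sumr_const card_ord mulr_natl.
Qed.

Lemma bounded_seq_cesaro x : bounded_seq x -> bounded_seq (cesaro_op x).
Proof. by move=> [K xK]; exists K; exact: cesaro_bound. Qed.

Lemma cesaroD x z : cesaro_op (fun n => x n + z n) =
  fun n => cesaro_op x n + cesaro_op z n.
Proof. by apply/funext => n; rewrite /cesaro_op big_split mulrDr. Qed.

Lemma ln2_gt0 : 0 < ln 2 :> R.
Proof. by rewrite ln_gt0// ltr1n. Qed.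

Lemma ln2_le1 : ln 2 <= 1 :> R.
Proof. by have := @le_ln1Dx R 1; rewrite -[1 + 1]/2; apply; lra. Qed.

Lemma ln_expr2 n : ln (2 ^+ n) = n%:R * ln 2 :> R.
Proof. by rewrite lnXn// mulr_natl. Qed.

Lemma dyadic_index_ln1D t : 0 <= t ->
  (dyadic_index t)%:R * ln 2 <= ln (1 + t) <= (dyadic_index t).+1%:R * ln 2.
Proof.
move=> t0; have /andP[lo hi] := dyadic_index_bounds t0.
have t10 : 0 < 1 + t by rewrite ltr_pwDl.
by rewrite -!ln_expr2 !ler_ln ?posrE ?exprn_gt0// lo (ltW hi).
Qed.

(** Passing from [ln (1 + t)] to [ln t] costs one [ln 2] below, as [1 + t <= 2 * t]. *)
Lemma dyadic_index_ln t : 1 <= t ->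
  (dyadic_index t)%:R * ln 2 - ln 2 <= ln t <= (dyadic_index t).+1%:R * ln 2.
Proof.
move=> t1; have t0 : 0 < t by exact: lt_le_trans t1.
have /andP[lo hi] := dyadic_index_ln1D (ltW t0).
apply/andP; split; last first.
  by apply: le_trans hi; rewrite ler_ln ?posrE ?addr_gt0// lerDr.
rewrite lerBlDr -lnM ?posrE//; apply: (le_trans lo).
by rewrite ler_ln ?posrE ?addr_gt0 ?mulr_gt0//; lra.
Qed.

(** Stated for abstract [F] and [L] to serve twice: with [L = ln t] for M, and with [L = ln (1 + t)]
    for the averages of singular values. *)
Lemma cvg_average_cesaro x (F L : R -> R) c : bounded_seq x ->
  L t @[t --> +oo] --> +oo -> (forall t, 1 < t -> 0 < L t) ->
  (forall t, 1 < t -> `|L t - (dyadic_index t).+1%:R * ln 2| <= c) ->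
  (forall t, 1 < t ->
     `|F t - ln 2 * \sum_(j < (dyadic_index t).+1) x j| <= c) ->
  ((L t)^-1 * F t - dyadic_step (cesaro_op x) t) @[t --> +oo] --> 0.
Proof.
move=> [K xK] Ly L0 Lc Fc.
apply: (@cvg0_le_div _ _ L (c + c * K)) => // t t1.
have Lt := L0 _ t1; rewrite -{2}(gtr0_norm Lt) -normrM mulrBl.
rewrite mulrAC mulVf ?gt_eqF// mul1r.
set S := \sum_(j < (dyadic_index t).+1) x j in Fc *.
(* With n the index of t, [(n + 1) * cesaro_op x n] is the sum of the x_j, so the two main terms
   cancel and only the two O(1) errors remain. *)
have -> : F t - dyadic_step (cesaro_op x) t * L t =
   (F t - ln 2 * \sum_(j < (dyadic_index t).+1) x j) -
   cesaro_op x (dyadic_index t) * (L t - (dyadic_index t).+1%:R * ln 2).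
  rewrite /dyadic_step /cesaro_op.
  have : (dyadic_index t).+1%:R != 0 :> R by [].
  move: (dyadic_index t).+1%:R => d d0; field.
  by rewrite d0.
apply: (le_trans (ler_normB _ _)); apply: lerD; first exact: Fc.
rewrite normrM mulrC ler_pM// ?Lc//; exact: cesaro_bound.
Qed.

(* Px is constant equal to x_j on [2^j - 1, 2^(j+1) - 1), where the logarithmic
   length exceeds ln 2 by nonnegative amounts that telescope. *)
Lemma log_integral_dyadic_step x K n : (forall n, `|x n| <= K) ->
  `|log_integral (dyadic_step x) (2 ^+ n.+1 - 1) - ln 2 * \sum_(j < n.+1) x j|
  <= K * (ln (2 ^+ n.+1 - 1) - n%:R * ln 2 + ln 2).
Proof.
move=> xK; have hx : Linf (dyadic_step x) by apply: Linf_dyadic_step; exists K.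
elim: n => [|n IH].
  (* The integral starts at 1, the right end of block 0, so it misses the term of [x 0]; the final
     [ln 2] in the bound pays for it. *)
  have -> : 2 ^+ 1 - 1 = 1 :> R by rewrite expr1; lra.
  rewrite log_integral1 ln1 big_ord1 !sub0r mul0r oppr0 add0r normrN normrM.
  by rewrite gtr0_norm ?ln2_gt0// mulrC ler_wpM2r// ltW// ln2_gt0.
set a := 2 ^+ n.+1 - 1 in IH *; set b := 2 ^+ n.+2 - 1.
have a1 : 1 <= a.
  rewrite /a exprS; have : 1 <= 2 ^+ n :> R by rewrite exprn_ege1 ?ler1n.
  by lra.
have ab : b = 2 * a + 1 by rewrite /a /b [2 ^+ n.+2]exprS; lra.
have hinc : log_integral (dyadic_step x) b - log_integral (dyadic_step x) a =
    x n.+1 * (ln b - ln a).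
  apply: log_integral_cstB => //; first by lra.
  by move=> u hu; rewrite /dyadic_step (dyadic_index_eq hu).
have d0 : 0 <= ln b - ln a - ln 2.
  rewrite -addrA -opprD -lnM ?posrE//; last by lra.
  by rewrite subr_ge0 ler_ln ?posrE; lra.
rewrite big_ord_recr/=.
have -> : log_integral (dyadic_step x) b - ln 2 * (\sum_(j < n.+1) x j + x n.+1) =
    (log_integral (dyadic_step x) a - ln 2 * \sum_(j < n.+1) x j) +
    x n.+1 * (ln b - ln a - ln 2).
  move: hinc; move: (log_integral _ b) => B hinc.
  have -> : B = x n.+1 * (ln b - ln a) + log_integral (dyadic_step x) a by lra.
  by ring.
apply: (le_trans (ler_normD _ _)); apply: (le_trans (lerD IH (lexx _))).
rewrite normrM (ger0_norm d0).
have h := ler_wpM2r d0 (xK n.+1).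
apply: (le_trans (lerD (lexx _) h)); rewrite -mulrDr.
rewrite le_eqVlt; apply/orP; left; apply/eqP; congr (_ * _).
by rewrite -[n.+1%:R]natr1; ring.
Qed.

Lemma cvg_Mop_dyadic_step x : bounded_seq x ->
  (Mop (dyadic_step x) t - dyadic_step (cesaro_op x) t) @[t --> +oo] --> 0.
Proof.
move=> bx; have [K xK] := bx; have hx := Linf_dyadic_step bx.
have K0 : 0 <= K by apply: le_trans (xK 0%N).
have l2 := ln2_gt0.
have : ((ln t)^-1 * log_integral (dyadic_step x) t -
   dyadic_step (cesaro_op x) t) @[t --> +oo] --> 0.
  (* One constant for both errors: [2 * ln 2] bounds that of the denominator; that of the numerator
     is at most [(2 + 2 + 1) * (K * ln 2)], from moving [t] to the left end of its block, from the
     full blocks, and from the last term of the sum. *)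
  apply: (@cvg_average_cesaro x _ _ (2 * ln 2 + 6 * (K * ln 2))) => //.
  - exact: cvg_lny.
  - by move=> t; exact: ln_gt0.
  - move=> t /ltW t1; have /andP[] := dyadic_index_ln t1.
    rewrite -[(dyadic_index t).+1%:R]natr1 => lo hi.
    have := mulr_ge0 K0 (ltW l2).
    by rewrite ler_norml; move=> ?; apply/andP; split; lra.
  - move=> t /ltW t1; have n0 := dyadic_index_gt0 t1.
    have t0 : 0 < t by exact: lt_le_trans t1.
    have /andP[lo hi] := dyadic_index_bounds (ltW t0).
    move: lo hi; case E : (dyadic_index t) n0 => [//|n] _ lo hi.
    set a := 2 ^+ n.+1 - 1 : R.
    have a1 : 1 <= a.
      rewrite /a exprS; have : 1 <= 2 ^+ n :> R by rewrite exprn_ege1 ?ler1n.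
      by lra.
    (* [t] lies in the block starting at [a]; the generous factor 4 is a power of 2, so its
       logarithm is [2 * ln 2]. *)
    have ta : t <= 4 * a.
      by move: hi a1; rewrite /a [2 ^+ n.+2]exprS; lra.
    have a0 : 0 < a by exact: lt_le_trans a1.
    have h1 := log_integral_dyadic_step n xK.
    rewrite -/a in h1.
    have lna : ln a <= n.+1%:R * ln 2.
      by rewrite -ln_expr2 ler_ln ?posrE ?exprn_gt0// /a gerBl.
    have h2 : `|log_integral (dyadic_step x) t - log_integral (dyadic_step x) a|
        <= K * (2 * ln 2).
      apply: (le_trans (log_integral_lip hx (fun u _ => xK _) a1 t1)).
      rewrite ler_wpM2l// ger0_norm; last first.
        by rewrite subr_ge0 ler_ln ?posrE// /a; lra.
      rewrite lerBlDr; have -> : 2 * ln 2 + ln a = ln (4 * a).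
        rewrite lnM ?posrE//; congr (_ + _).
        have -> : 4 = 2 ^+ 2 :> R by rewrite expr2; lra.
        by rewrite ln_expr2.
      by rewrite ler_ln ?posrE// mulr_gt0.
    rewrite big_ord_recr/=; set S := \sum_(j < n.+1) x j in h1 *.
    have h3 : `|x n.+1 * ln 2| <= K * ln 2.
      by rewrite normrM (gtr0_norm l2) ler_wpM2r// ltW.
    have h4 : K * (ln a - n%:R * ln 2 + ln 2) <= K * (2 * ln 2).
      by rewrite ler_wpM2l//; move: lna; rewrite -natr1; lra.
    have Kl : 0 <= K * ln 2 by rewrite mulr_ge0// ltW.
    have := le_trans h1 h4; move: h2 h3 Kl; rewrite !ler_norml.
    have -> : ln 2 * (S + x n.+1) = ln 2 * S + x n.+1 * ln 2 by ring.
    have -> : K * (2 * ln 2) = 2 * (K * ln 2) by ring.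
    move: (x n.+1 * ln 2) (ln 2 * S) (K * ln 2) => u v w.
    by move=> /andP[? ?] /andP[? ?] ? /andP[? ?]; apply/andP; split; lra.
apply: cvg_trans; apply: near_eq_cvg; near=> t.
have t1 : 1 < t by near: t; apply: nbhs_pinfty_gt; rewrite num_real.
by rewrite MopE.
Unshelve. all: by end_near. Qed.

Lemma bounded_seq_Mop y : Linf y -> bounded_seq (fun n => Mop y (2 ^+ n)).
Proof.
by move=> hy; have [_ [K yK]] := hy; exists K => n; exact: Mop_bound.
Qed.

(** Between [t] and [2 ^ n] the logarithm moves by at most [ln 2] and the integral by at most
    [K * ln 2], so their quotient moves by O(1 / ln t). *)
Lemma cvg_Mop_sample y : Linf y ->
  (Mop y t - dyadic_step (fun n => Mop y (2 ^+ n)) t) @[t --> +oo] --> 0.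
Proof.
move=> hy; have [_ [K yK]] := hy; have l2 := ln2_gt0.
have K0 : 0 <= K by apply: le_trans (yK 1 _).
apply: (@cvg0_le_div _ _ (@ln R) (2 * (K * ln 2))); first exact: cvg_lny.
move=> t t1; rewrite /dyadic_step; have n0 := dyadic_index_gt0 (ltW t1).
have /andP[] := dyadic_index_ln (ltW t1).
set n := dyadic_index t in n0 *; rewrite -[n.+1%:R]natr1 -ln_expr2 => lo hi.
(* Since [t > 1] lies beyond block 0, the sample point exceeds 1 and avoids the default value 0 of
   [Mop]. *)
have p1 : 1 < 2 ^+ n :> R by rewrite exprn_egt1 -?lt0n ?ltr1n.
have dist : `|ln t - ln (2 ^+ n)| <= ln 2.
  rewrite ler_norml; apply/andP; split; first by lra.
  by move: hi; rewrite mulrDl mul1r -ln_expr2; lra.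
have lt0 := ln_gt0 t1; have lp0 := ln_gt0 p1.
rewrite -[X in _ * X](gtr0_norm lt0) -normrM.
have -> : (Mop y t - Mop y (2 ^+ n)) * ln t =
    (log_integral y t - log_integral y (2 ^+ n)) -
    Mop y (2 ^+ n) * (ln t - ln (2 ^+ n)).
  by rewrite !MopE//; field; rewrite !gt_eqF.
apply: (le_trans (ler_normB _ _)); rewrite mulr_natl mulr2n; apply: lerD.
  apply: (le_trans (log_integral_lip hy yK (ltW p1) (ltW t1))).
  by rewrite ler_wpM2l.
by rewrite normrM ler_pM//; exact: Mop_bound.
Qed.

End DyadicSteps.

(** * Dyadic block sums of singular values and the averages defining the trace *)

Section SingularValueAverages.
Variable R : realType.
Implicit Types (x z : nat -> R) (y : R -> R) (A : op R) (om : (R -> R) -> R).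

(** Iterating this trades each further M on functions for a further C on sequences. *)
Lemma cvg_Mop_near_step y z : Linf y -> bounded_seq z ->
  (y t - dyadic_step z t) @[t --> +oo] --> 0 ->
  (Mop y t - dyadic_step (cesaro_op z) t) @[t --> +oo] --> 0.
Proof.
move=> hy bz yz; have hz := Linf_dyadic_step bz.
have -> : (fun t => Mop y t - dyadic_step (cesaro_op z) t) =
    fun t => (Mop y t - Mop (dyadic_step z) t) +
             (Mop (dyadic_step z) t - dyadic_step (cesaro_op z) t).
  by apply/funext => t; rewrite addrA subrK.
rewrite -[X in _ --> X]addr0; apply: cvgD; first exact: cvg_MopB.
exact: cvg_Mop_dyadic_step.
Qed.

Lemma extended_limit_Mop_step om z : extended_limit om -> bounded_seq z ->
  om (Mop (dyadic_step z)) = om (dyadic_step (cesaro_op z)).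
Proof.
move=> hom bz; apply: extended_limit_eq => //.
- exact/Linf_Mop/Linf_dyadic_step.
- exact/Linf_dyadic_step/bounded_seq_cesaro.
- exact: cvg_Mop_dyadic_step.
Qed.

(** Normalised to undo [Dop]: it returns [x] on [diag (Dop x)] when [Dop x] is nonnegative and
    nonincreasing. *)
Definition dyadic_mass A : nat -> R := fun n =>
  (ln 2)^-1 * \sum_((2 ^ n).-1 <= k < (2 ^ n.+1).-1) mu A k.

Lemma predn_exp2_leS n : ((2 ^ n).-1 <= (2 ^ n.+1).-1)%N.
Proof. by rewrite expnS; lia. Qed.

Lemma sum_mu_dyadic A n :
  \sum_(0 <= k < (2 ^ n).-1) mu A k = ln 2 * \sum_(j < n) dyadic_mass A j.
Proof.
elim: n => [|n IH]; first by rewrite big_ord0 mulr0 big_geq.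
rewrite (big_cat_nat (leq0n _) (predn_exp2_leS n))//= IH.
rewrite big_ord_recr/= mulrDr; congr (_ + _).
by rewrite /dyadic_mass mulrA mulfV ?mul1r// gt_eqF// ln2_gt0.
Qed.

(** The block has [2 ^ n] indices [k], all with [k + 1 >= 2 ^ n], so each singular value in it is at
    most [K / 2 ^ n]. *)
Lemma dyadic_mass_bound A (K : R) : (forall n, n.+1%:R * mu A n <= K) ->
  forall n, 0 <= ln 2 * dyadic_mass A n <= K.
Proof.
move=> hK n; rewrite /dyadic_mass mulrA mulfV ?mul1r ?gt_eqF ?ln2_gt0//.
apply/andP; split; first by apply: sumr_ge0 => k _; exact: mu_ge0.
have p0 : (0 : R) < 2 ^+ n by rewrite exprn_gt0.
apply: (@le_trans _ _ (\sum_((2 ^ n).-1 <= k < (2 ^ n.+1).-1) (K / 2 ^+ n))).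
  rewrite !big_nat; apply: ler_sum => k /andP[nk _].
  rewrite ler_pdivlMr// mulrC; apply: le_trans (hK k).
  rewrite ler_wpM2r ?mu_ge0// -natrX ler_nat.
  by have := expn_gt0 2 n; lia.
rewrite sumr_const_nat -[leLHS]mulr_natr.
have -> : ((2 ^ n.+1).-1 - (2 ^ n).-1 = 2 ^ n)%N.
  by rewrite expnS; have := expn_gt0 2 n; lia.
by rewrite natrX divfK// gt_eqF.
Qed.

(** The sum runs to the end of the block containing [t]; what it has beyond [int_mu A t] is part of
    the mass of that one block. *)
Lemma int_mu_dyadic A (K t : R) : (forall n, n.+1%:R * mu A n <= K) -> 0 <= t ->
  0 <= ln 2 * \sum_(j < (dyadic_index t).+1) dyadic_mass A j - int_mu A t <= K.
Proof.
move=> hK t0; rewrite /int_mu; have /andP[lo hi] := truncn_itv t0.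
set N := Num.truncn t in lo hi *; set n := dyadic_index t.
have /andP[n1 n2] : ((2 ^ n).-1 <= N < (2 ^ n.+1).-1)%N.
  have := trunc_log_bounds (isT : (1 < 2)%N) (ltn0Sn N).
  by rewrite -/(dyadic_index t) -/n => /andP[]; lia.
have m0 := mu_ge0 A.
have fr : 0 <= (t - N%:R) * mu A N <= mu A N.
  rewrite mulr_ge0 ?subr_ge0//= ler_piMl//.
  by move: hi; rewrite -natr1 lerBlDl => /ltW.
have sN : \sum_(k < N) mu A k = \sum_(0 <= k < N) mu A k by rewrite big_mkord.
have s1 : \sum_(0 <= k < (2 ^ n).-1) mu A k <= \sum_(0 <= k < N) mu A k.
  by rewrite (big_cat_nat (leq0n _) n1)//= lerDl sumr_ge0.
have s2 : \sum_(0 <= k < N) mu A k + mu A N <= \sum_(0 <= k < (2 ^ n.+1).-1) mu A k.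
  by rewrite -big_nat_recr//= (big_cat_nat (leq0n _) n2)//= lerDl sumr_ge0.
have /andP[b1 b2] := dyadic_mass_bound hK n.
move: s1 s2 fr; rewrite -sN !sum_mu_dyadic big_ord_recr/= mulrDr.
by move=> s1 s2 /andP[f1 f2]; apply/andP; split; lra.
Qed.

Lemma int_mu_ge0 A (t : R) : 0 <= t -> 0 <= int_mu A t.
Proof.
move=> t0; have /andP[lo _] := truncn_itv t0.
rewrite addr_ge0 ?sumr_ge0 ?mulr_ge0 ?subr_ge0 ?mu_ge0// => i _.
exact: mu_ge0.
Qed.

Lemma bounded_seq_dyadic_mass A : L1inf A -> bounded_seq (dyadic_mass A).
Proof.
move=> [_ [_ [K hK]]]; exists (K / ln 2) => n.
have /andP[b1 b2] := dyadic_mass_bound hK n.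
have l2 := @ln2_gt0 R.
rewrite ler_pdivlMr// mulrC -{1}(gtr0_norm l2) -normrM ger0_norm//.
Qed.

(** [Linf] asks for a bound on all of (0, oo), also near 0 where the logarithm vanishes. For [t < 1]
    the numerator is at most [t * K]; for [t >= 1] the index n is positive, and [n + 1 <= 2 * n]
    gives the factor 2 in the bound. *)
Lemma Linf_trace_average A : L1inf A ->
  Linf (fun t => (ln (1 + t))^-1 * int_mu A t).
Proof.
move=> [_ [_ [K hK]]]; have l2 := @ln2_gt0 R.
have K0 : 0 <= K by apply: le_trans (hK 0%N); rewrite mul1r mu_ge0.
split.
  apply: measurable_funM.
    apply: open_continuous_measurable_fun; first exact: interval_open.
    move=> t; rewrite inE /pos_half/= in_itv/= andbT => t0.
    have t1 : 1 < 1 + t by rewrite ltrDl.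
    apply: cvgV; first by rewrite gt_eqF// ln_gt0.
    have c : (1 + s) @[s --> t] --> 1 + t.
      by apply: cvgD; [exact: cvg_cst|exact: cvg_id].
    by apply: (cvg_comp _ _ c); apply: continuous_ln; exact: lt_trans t1.
  apply: measurable_funD.
    exact: (measurable_comp_truncn (fun n => \sum_(k < n) mu A k)).
  apply: measurable_funM; last exact: (measurable_comp_truncn (mu A)).
  apply: measurable_funB => //.
  exact: (measurable_comp_truncn (fun n => n%:R)).
exists (2 * K / ln 2) => t t0.
have ln0 : 0 < ln (1 + t) by rewrite ln_gt0// ltrDl.
have K2 : 2 * K <= 2 * K / ln 2.
  by rewrite ler_pdivlMr// ler_piMr ?ln2_le1// mulr_ge0.
rewrite normrM normfV (gtr0_norm ln0) ler_pdivrMl//.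
rewrite ger0_norm; last exact/int_mu_ge0/ltW.
have [t1|t1] := ltP t 1.
  rewrite /int_mu; have -> : Num.truncn t = 0%N by apply/truncn0Pn; rewrite -ltNge.
  rewrite big_ord0 add0r subr0.
  have mK : mu A 0 <= K by apply: le_trans (hK 0%N); rewrite mul1r.
  (* [ln u <= u - 1] at [u = 1 / (1 + t)] gives [ln (1 + t) >= t / (1 + t)], and [t < 1]. *)
  have tln : t / 2 <= ln (1 + t).
    have t10 : 0 < 1 + t by rewrite addr_gt0.
    have := @le_ln1Dx R ((1 + t)^-1 - 1).
    rewrite [1 + (_ - 1)]addrC subrK lnV ?posrE// => h.
    have i0 : 0 < (1 + t)^-1 by rewrite invr_gt0.
    have {}h : - ln (1 + t) <= (1 + t)^-1 - 1 by apply: h; lra.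
    have : (1 + t)^-1 <= 1 - t / 2.
      by rewrite -[leLHS]div1r ler_pdivrMr//; nra.
    by lra.
  apply: (@le_trans _ _ (t / 2 * (2 * K))).
    have -> : t / 2 * (2 * K) = t * K by field.
    by rewrite ler_wpM2l// ltW.
  by rewrite ler_pM// ?divr_ge0 ?mulr_ge0// ltW.
have /andP[b1 _] := int_mu_dyadic hK (ltW t0).
have n0 := dyadic_index_gt0 t1.
have /andP[l1 _] := dyadic_index_ln1D (ltW t0).
set n := dyadic_index t in b1 n0 l1.
have b3 : ln 2 * \sum_(j < n.+1) dyadic_mass A j <= n.+1%:R * K.
  rewrite mulr_sumr; apply: (@le_trans _ _ (\sum_(j < n.+1) K)).
    by apply: ler_sum => j _; have /andP[] := dyadic_mass_bound hK j.
  by rewrite sumr_const card_ord mulr_natl.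
apply: (@le_trans _ _ (n.+1%:R * K)); first by lra.
apply: (@le_trans _ _ (n%:R * ln 2 * (2 * K / ln 2))); last first.
  by rewrite ler_wpM2r// divr_ge0 ?mulr_ge0// ltW.
have -> : n%:R * ln 2 * (2 * K / ln 2) = (2 * n%:R) * K by field; rewrite gt_eqF.
by rewrite ler_wpM2r// -natrM ler_nat; lia.
Qed.

Lemma Tr_omega_dyadic om A : extended_limit om -> L1inf A ->
  Tr_omega om A = om (dyadic_step (cesaro_op (dyadic_mass A))).
Proof.
move=> hom hA; have bm := bounded_seq_dyadic_mass hA.
have [_ [_ [K hK]]] := hA; have l2 := @ln2_gt0 R.
have K0 : 0 <= K by apply: le_trans (hK 0%N); rewrite mul1r mu_ge0.
apply: extended_limit_eq => //.
- exact: Linf_trace_average.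
- exact/Linf_dyadic_step/bounded_seq_cesaro.
apply: (@cvg_average_cesaro _ _ _ (fun t => ln (1 + t)) (ln 2 + K)) => //.
- apply/cvgryPge => B; have /cvgryPge/(_ B) hB := @cvg_lny R.
  near=> t; have t1 : 0 < t by near: t; apply: nbhs_pinfty_gt; rewrite num_real.
  apply: (@le_trans _ _ (ln t)); first by near: t.
  by rewrite ler_ln ?posrE ?addr_gt0// lerDr.
- by move=> t t1; rewrite ln_gt0// ltrDl (lt_trans _ t1).
- move=> t t1; have t0 : 0 <= t by rewrite ltW// (lt_trans _ t1).
  have /andP[] := dyadic_index_ln1D t0; rewrite -[_.+1%:R]natr1 => lo hi.
  by rewrite ler_norml; apply/andP; split; lra.
- move=> t t1; have t0 : 0 <= t by rewrite ltW// (lt_trans _ t1).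
  have /andP[lo hi] := int_mu_dyadic hK t0.
  by rewrite ler_norml; apply/andP; split; lra.
Unshelve. all: by end_near. Qed.

End SingularValueAverages.

(** * The operators [diag (Dop x)] and the Banach limit in terms of the extended limit *)

Section DiagonalLift.
Variable R : realType.
Implicit Types (x z : nat -> R).

Lemma Dop_le x (K : R) k : (forall n, `|x n| <= K) ->
  `|Dop x k| <= 2 * K / k.+1%:R.
Proof.
move=> xK; have K0 : 0 <= K by apply: le_trans (xK 0%N).
have l2 := @ln2_gt0 R; rewrite /Dop; set m := trunc_log 2 k.+1.
have p0 : (0 : R) < 2 ^+ m by rewrite exprn_gt0.
have k0 : (0 : R) < k.+1%:R by rewrite ltr0n.
rewrite normrM normfV (gtr0_norm p0) normrM (gtr0_norm l2).
rewrite ler_pdivrMr// mulrAC ler_pdivlMr//.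
have km : k.+1%:R <= 2 * 2 ^+ m :> R.
  by rewrite -exprS -natrX ler_nat ltnW// trunc_log_ltn.
apply: (@le_trans _ _ (K * (2 * 2 ^+ m))); last by rewrite mulrCA mulrA.
rewrite ler_pM// ?mulr_ge0// ?(ltW l2)//.
by rewrite -[leRHS]mul1r ler_pM ?ln2_le1// ltW.
Qed.

Lemma Dop_norm_le x (K : R) k : (forall n, `|x n| <= K) ->
  `|Dop x k| <= Dop (fun=> K) k.
Proof.
move=> xK; have l2 := @ln2_gt0 R; rewrite /Dop; set m := trunc_log 2 k.+1.
have p0 : (0 : R) < 2 ^+ m by rewrite exprn_gt0.
rewrite !normrM normfV (gtr0_norm l2) (gtr0_norm p0).
by rewrite ler_wpM2r ?invr_ge0 ?(ltW p0)// ler_wpM2l// ltW.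
Qed.

(* x_(n+1) <= 2 x_n is exactly what makes the blocks of Dop x decrease. *)
Lemma Dop_nonincreasing x (c : R) : 0 <= c -> (forall n, c <= x n <= 2 * c) ->
  forall j k, (j <= k)%N -> Dop x k <= Dop x j.
Proof.
move=> c0 xc j k jk; rewrite /Dop -!mulrA; apply: ler_wpM2l (ltW (@ln2_gt0 R)) _ _ _.
have := @leq_trunc_log 2 j.+1 k.+1 jk.
move: (trunc_log 2 j.+1) (trunc_log 2 k.+1) => a b.
rewrite leq_eqVlt => /predU1P[->//|ab].
have pa : (0 : R) < 2 ^+ a by rewrite exprn_gt0.
have pb : (0 : R) < 2 ^+ b by rewrite exprn_gt0.
have /andP[xa _] := xc a; have /andP[_ xb] := xc b.
apply: (@le_trans _ _ (c / 2 ^+ a)); last by rewrite ler_wpM2r// invr_ge0 ltW.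
rewrite ler_pdivrMr// mulrAC ler_pdivlMr//.
apply: (@le_trans _ _ (c * 2 ^+ a.+1)).
  by rewrite exprS mulrA [c * 2]mulrC ler_wpM2r// ltW.
by rewrite ler_wpM2l// ler_weXn2l// ler1n.
Qed.

Lemma L1inf_diag_Dop x : bounded_seq x -> L1inf (diag (Dop x)).
Proof.
move=> [K xK]; have K0 : 0 <= K by apply: le_trans (xK 0%N).
have mu_le n : mu (diag (Dop x)) n <= 2 * K / n.+1%:R.
  (* The constant sequence [K] yields a nonincreasing majorant, whatever the signs and order of the
     entries of [Dop x]. *)
  apply: (@le_trans _ _ (Dop (fun=> K) n)).
    apply: mu_diag_le => [k|]; first exact: Dop_norm_le.
    by apply: (@Dop_nonincreasing _ K) => // n0; apply/andP; split; lra.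
  apply: le_trans (ler_norm _) _; apply: Dop_le => _; rewrite ger0_norm//.
split; [|split].
- apply: (@bounded_op_diag _ _ (2 * K)) => k; apply: (le_trans (Dop_le k xK)).
  by rewrite ler_pdivrMr ?ltr0n// ler_peMr ?mulr_ge0// ler1n.
- move=> e e0; exists (Num.truncn (2 * K / e)) => n Nn.
  apply: le_lt_trans (mu_le n) _; rewrite ltr_pdivrMr ?ltr0n// [e * _]mulrC -ltr_pdivrMr//.
  by apply: lt_le_trans (truncnS_gt _) _; rewrite ler_nat ltnS.
- exists (2 * K) => n; rewrite mulrC -ler_pdivlMr ?ltr0n//.
Qed.

(** The singular values are the entries themselves, and block [n] consists of [2 ^ n] copies of
    [ln 2 * x n / 2 ^ n]. *)
Lemma dyadic_mass_diag x (c : R) : 0 <= c -> (forall n, c <= x n <= 2 * c) ->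
  dyadic_mass (diag (Dop x)) = x.
Proof.
move=> c0 xc; apply/funext => n; rewrite /dyadic_mass.
have l2 := @ln2_gt0 R.
have D0 k : 0 <= Dop x k.
  rewrite /Dop divr_ge0 ?exprn_ge0// mulr_ge0 ?(ltW l2)//.
  by have /andP[] := xc (trunc_log 2 k.+1); lra.
have -> : \sum_((2 ^ n).-1 <= k < (2 ^ n.+1).-1) mu (diag (Dop x)) k =
    \sum_((2 ^ n).-1 <= k < (2 ^ n.+1).-1) (ln 2 * x n / 2 ^+ n).
  rewrite !big_nat; apply: eq_bigr => k /andP[k1 k2].
  rewrite mu_diag//; last exact: Dop_nonincreasing xc.
  rewrite /Dop (@trunc_log_eq 2 n k.+1)//.
  by have := expn_gt0 2 n; move: k1 k2; rewrite expnS; lia.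
rewrite sumr_const_nat -[ln 2 * x n / 2 ^+ n *+ _]mulr_natr.
have -> : ((2 ^ n.+1).-1 - (2 ^ n).-1 = 2 ^ n)%N.
  by rewrite expnS; have := expn_gt0 2 n; lia.
by rewrite natrX divfK ?gt_eqF ?exprn_gt0// mulKf// gt_eqF.
Qed.

Lemma trace_diag_Dop (tau : op R -> R[i]) om x (c : R) : extended_limit om ->
  (forall A, L1inf A -> positive_op A -> tau A = (Tr_omega om A)%:C) ->
  0 <= c -> (forall n, c <= x n <= 2 * c) ->
  tau (diag (Dop x)) = (om (dyadic_step (cesaro_op x)))%:C.
Proof.
move=> hom htau c0 xc.
have xb n : `|x n| <= 2 * c.
  by have /andP[h1 h2] := xc n; rewrite ger0_norm//; lra.
have hL : L1inf (diag (Dop x)) by apply: L1inf_diag_Dop; exists (2 * c).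
rewrite htau//; first by rewrite Tr_omega_dyadic// (dyadic_mass_diag c0 xc).
apply: (@positive_op_diag _ _ (2 * (2 * c))) => k; apply/andP; split.
  rewrite /Dop divr_ge0 ?exprn_ge0// mulr_ge0 ?(ltW (@ln2_gt0 R))//.
  by have /andP[] := xc (trunc_log 2 k.+1); lra.
apply: le_trans (ler_norm _) _; apply: (le_trans (Dop_le k xb)).
by rewrite ler_pdivrMr ?ltr0n// ler_peMr ?mulr_ge0// ler1n.
Qed.

(* Adding a large constant to x makes Dop x nonnegative and nonincreasing, hence
   equal to its own sequence of singular values. *)
Lemma banach_limit_ofE (tau : op R -> R[i]) om x : extended_limit om ->
  (forall A B, L1inf A -> L1inf B -> tau (opadd A B) = tau A + tau B) ->
  (forall A, L1inf A -> positive_op A -> tau A = (Tr_omega om A)%:C) ->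
  bounded_seq x ->
  banach_limit_of tau x = (om (dyadic_step (cesaro_op x)))%:C.
Proof.
move=> hom tauD htau bx; have [K xK] := bx.
have K0 : 0 <= K by apply: le_trans (xK 0%N).
have bc : bounded_seq (fun=> 3 * K) by exists `|3 * K|.
(* The shift by [3 * K] moves [-K, K] to [2 K, 4 K], an interval of the required form [c, 2 c]. *)
have e1 : tau (diag (Dop (fun n => x n + 3 * K))) =
    (om (dyadic_step (cesaro_op (fun n => x n + 3 * K))))%:C.
  apply: (@trace_diag_Dop _ _ _ (2 * K)) => //; first by rewrite mulr_ge0.
  by move=> n; have := xK n; rewrite ler_norml => /andP[h1 h2]; apply/andP; split; lra.
have e2 : tau (diag (Dop (fun=> 3 * K))) =
    (om (dyadic_step (cesaro_op (fun=> 3 * K))))%:C.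
  apply: (@trace_diag_Dop _ _ _ (3 * K)) => //; first by rewrite mulr_ge0.
  by move=> n; apply/andP; split; lra.
have e3 : diag (Dop (fun n => x n + 3 * K)) =
    opadd (diag (Dop x)) (diag (Dop (fun=> 3 * K))).
  apply/funext => v; apply/funext => k; rewrite /opadd /diag -mulrDl -rmorphD.
  by congr (_%:C * _); rewrite /Dop mulrDr mulrDl.
have e4 : om (dyadic_step (cesaro_op (fun n => x n + 3 * K))) =
    om (dyadic_step (cesaro_op x)) + om (dyadic_step (cesaro_op (fun=> 3 * K))).
  rewrite cesaroD; have [omD _] := hom; rewrite -omD//.
    exact/Linf_dyadic_step/bounded_seq_cesaro.
  exact/Linf_dyadic_step/bounded_seq_cesaro.
move: e1; rewrite e3 tauD; try exact: L1inf_diag_Dop.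
by rewrite e2 e4 rmorphD => /addIr.
Qed.

End DiagonalLift.

Theorem theorem5p15 (R : realType) (tau : op R -> R[i]) :
  dixmier_trace tau ->
  (generated_by_M_invariant tau <->
   (forall x : nat -> R, bounded_seq x ->
      banach_limit_of tau (cesaro_op x) = banach_limit_of tau x)).
Proof.
move=> [tauD [_ [om0 [hom0 [_ htau0]]]]]; split.
  move=> [om [hom [omM htau]]] x bx; have bcx := bounded_seq_cesaro bx.
  rewrite !(banach_limit_ofE hom tauD htau)//.
  by rewrite -extended_limit_Mop_step// omM//; exact: Linf_dyadic_step.
move=> Bc.
(* One C on each side comes from B itself, so this is invariance on Cesaro means only. *)
have omC x : bounded_seq x ->
    om0 (dyadic_step (cesaro_op (cesaro_op x))) = om0 (dyadic_step (cesaro_op x)).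
  move=> bx; have := Bc x bx; rewrite !(banach_limit_ofE hom0 tauD htau0)//.
    by case.
  exact: bounded_seq_cesaro.
have omE y z : Linf y -> bounded_seq z ->
    (y t - dyadic_step z t) @[t --> +oo] --> 0 -> om0 y = om0 (dyadic_step z).
  by move=> hy bz; apply: extended_limit_eq => //; exact: Linf_dyadic_step.
exists (fun y => om0 (Mop (Mop y))); split; [|split].
- exact: extended_limit_comp_Mop (extended_limit_comp_Mop hom0).
- move=> y hy; pose z n := Mop y (2 ^+ n).
  have bz : bounded_seq z by exact: bounded_seq_Mop.
  have bCz := bounded_seq_cesaro bz; have hMy := Linf_Mop hy.
  have h1 := cvg_Mop_near_step hMy bz (cvg_Mop_sample hy).
  (* Two applications of M to [y] match C z and three match C (C z), a pair that [omC]
     identifies. *)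
  have h2 := cvg_Mop_near_step (Linf_Mop hMy) bCz h1.
  rewrite (omE _ _ _ _ h2); [|by do 3 apply: Linf_Mop|exact: bounded_seq_cesaro].
  by rewrite (omE _ _ _ _ h1)// ?omC//; exact: Linf_Mop.
- move=> A hA pA; rewrite htau0//; congr (_%:C).
  have bm := bounded_seq_dyadic_mass hA.
  rewrite Tr_omega_dyadic// (@Tr_omega_dyadic _ (fun y => om0 (Mop (Mop y))))//; last first.
    exact: extended_limit_comp_Mop (extended_limit_comp_Mop hom0).
  have bc := bounded_seq_cesaro bm; have bcc := bounded_seq_cesaro bc.
  have hs := Linf_dyadic_step bc.
  (* For the block masses m of [A], the trace average matches C m, and two more applications of M
     give C (C (C m)); [omC] is used twice to return to C m. *)
  have h := cvg_Mop_near_step (Linf_Mop hs) bcc (cvg_Mop_dyadic_step bc).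
  rewrite (omE _ _ _ _ h) ?omC//; last exact: bounded_seq_cesaro.
  by do 2 apply: Linf_Mop.
Qed.
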